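(* For any graph $G$ with $\chi(G)=k$ and any $d>0$, we have $$\mathbb{P}\left(\chi(G_{1/2})\le d\right)\le\begin{cases}\exp\left(-\Omega\left((k^{1/2}-d)^2/k^{1/2}\right)\right) & \text{for } k^{1/2}/2\le d\le k^{1/2},\\ \exp\left(-\Omega(k/d)\right) & \text{for } k^{1/3}\le d\le k^{1/2}/2,\text{ and}\\ \exp\left(-\Omega(k(k-d^3))/d^3\right) & \text{for } d\le k^{1/3}.\end{cases}$$
   Context: For a graph $G$ and $p\in(0,1)$, $G_p$ denotes the random subgraph of $G$ (on the same vertex set) obtained by including each edge of $G$ independently with probability $p$. The chromatic number $\chi(G)$ is the smallest number of colours needed to colour the vertices of $G$ so that no two adjacent vertices share the same colour. The notation $\Omega(\cdot)$ denotes a quantity bounded below by a positive absolute constant (independent of $G$, $k$ and $d$) times its argument. *)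

(* Defs.v *)
From HB Require Import structures.
From mathcomp Require Import all_boot all_order all_algebra.

Set Implicit Arguments.
Unset Strict Implicit.
Unset Printing Implicit Defensive.

Import Order.TTheory GRing.Theory Num.Theory.
Local Open Scope ring_scope.

Record sgraph := SGraph {
  vertex :> finType;
  adj : rel vertex;
  adj_sym : symmetric adj;
  adj_irr : irreflexive adj }.

Definition edges (G : sgraph) : {set {set G}} :=
  [set [set e.1; e.2] | e : G * G & adj e.1 e.2].

Section Subgraph.
Variables (G : sgraph) (F : {set {set G}}).

Definition sub_adj : rel G := fun x y => adj x y && ([set x; y] \in F).

Lemma sub_adj_sym : symmetric sub_adj.
Proof. by move=> x y; rewrite /sub_adj adj_sym setUC. Qed.

Lemma sub_adj_irr : irreflexive sub_adj.
Proof. by move=> x; rewrite /sub_adj adj_irr. Qed.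

Definition spanning_subgraph : sgraph := SGraph sub_adj_sym sub_adj_irr.

End Subgraph.

Definition colorable (G : sgraph) (k : nat) : bool :=
  [exists f : {ffun G -> 'I_k}, forall x, forall y, adj x y ==> (f x != f y)].

Lemma colorable_ex (G : sgraph) : exists k, colorable G k.
Proof.
exists #|G|; apply/existsP; exists [ffun x => enum_rank x].
apply/forallP=> x; apply/forallP=> y; apply/implyP; apply: contraTneq.
by rewrite !ffunE => /enum_rank_inj ->; rewrite adj_irr.
Qed.

Definition chi (G : sgraph) : nat := ex_minn (colorable_ex G).

Section RandomSubgraph.
Variables (R : numDomainType) (p : R) (G : sgraph).

(* Probability that the edge set of G_p is exactly F, for F \subset edges G. *)
Definition Gp_weight (F : {set {set G}}) : R :=
  \prod_(e in edges G) (if e \in F then p else 1 - p).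

(* P(A(G_p)) for a graph property A. *)
Definition Gp_prob (A : pred sgraph) : R :=
  \sum_(F in powerset (edges G) | A (spanning_subgraph F)) Gp_weight F.

Lemma Gp_prob_total : Gp_prob predT = 1.
Proof.
pose a e := if e \in edges G then p else 0.
pose b e := if e \in edges G then 1 - p else 1.
transitivity (\prod_(e : {set G}) (a e + b e)); last first.
  by rewrite big1 // => e _; rewrite /a /b; case: ifP; rewrite ?subrKC ?add0r.
rewrite bigA_distr /Gp_prob.
rewrite (eq_bigl (fun F : {set {set G}} => F \subset edges G)); last first.
  by move=> F; rewrite powersetE andbT.
rewrite [RHS](bigID (fun F : {set {set G}} => F \subset edges G)) /=.
rewrite [X in _ + X]big1 ?addr0 => [|F /subsetPn[e eF /negPf eG]].
  apply: eq_bigr => F /subsetP sFE; rewrite /Gp_weight big_mkcond /=.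
  apply: eq_bigr => e _; rewrite /a /b; case: ifP => // /negbT eG.
  by rewrite (contraNF (sFE e) eG).
by rewrite (bigD1 e) //= eF /a eG mul0r.
Qed.

End RandomSubgraph.

(* Main.v *)
Require Import Defs.
From mathcomp Require Import all_boot all_order all_algebra.
From mathcomp Require Import reals sequences exp.
From mathcomp Require Import ring lra zify.
Set Implicit Arguments.
Unset Strict Implicit.
Unset Printing Implicit Defensive.
Import Order.TTheory GRing.Theory Num.Theory.
Local Open Scope ring_scope.

(** Let A be the family of edge sets x such that the subgraph x of G has
    chromatic number at most d, and let P be its probability under the uniform
    distribution. Two facts about A, each combined with an isoperimetric
    inequality on the cube of edge sets, give the three bounds.

    For d <= sqrt k, fix an optimal proper colouring f of G and split the edges
    into k blocks, the block of an edge being the larger colour of its two ends.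
    Suppose that x and the complement of y both lie in A, and let J be the set of
    blocks on which x and y differ. An edge with no end coloured in J belongs to
    a block where x and y agree, so it lies in x or in the complement of y, and
    the vertices with colour outside J are properly coloured with at most d^2
    colours by pairing a d-colouring of x with one of the complement of y. The
    other vertices keep their colour under f. Hence k <= d^2 + #|J|
    ([separated_blocks]): A and its image under complementation, which have the
    same probability P, are at Hamming distance at least k - d^2 in a product of
    k spaces. This forces P^2 <= exp(-(k - d^2)^2 / 8k)
    ([separated_blocks_Pr], [chi_half_block_tail]), which implies both of
    the first two bounds.

    For d <= k^(1/3), let x, y, z be in A. Their d-colourings combine into a map
    to at most d^3 colours, whose monochromatic edges avoid x, y and z. If the
    colour class a needs k_a colours, it contains at least k_a (k_a - 1) / 2
    edges, and the k_a sum to at least k, so by convexity there are at least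
    t = k (k - d^3) / (2 d^3) monochromatic edges ([mono_edges_lb],
    [uncovered_edges]). A family any three members of which jointly miss t points
    satisfies P^3 <= exp(-t/2) ([three_wise_Pr], [chi_half_edge_tail]).

    Both isoperimetric inequalities are instances of a tensorization principle
    ([avg_tensor]) of Prekopa-Leindler type: from a pointwise bound on
    f x * g y * h z by a product of kernels, one for each block of coordinates,
    one gets a bound on the product of the three averages, as soon as this holds
    for functions of a single block. *)

(** * Averages over the subsets of a finite type *)

Definition avg (R : realFieldType) (T : finType) (f : {set T} -> R) : R :=
  (\sum_x f x) / #|{set T}|%:R.

Lemma card_sets_gt0 (R : realFieldType) (T : finType) :
  0 < #|{set T}|%:R :> R.
Proof. by rewrite ltr0n; apply/card_gt0P; exists set0. Qed.

Lemma sum_const_sets (R : realFieldType) (T : finType) (a : R) :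
  \sum_(x : {set T}) a = a * #|{set T}|%:R.
Proof. by rewrite sumr_const mulr_natr. Qed.

Lemma avg_ge0 (R : realFieldType) (T : finType) (f : {set T} -> R) :
  (forall x, 0 <= f x) -> 0 <= avg f.
Proof. by move=> f0; rewrite divr_ge0 ?sumr_ge0. Qed.

Lemma eq_avg (R : realFieldType) (T : finType) (f g : {set T} -> R) :
  f =1 g -> avg f = avg g.
Proof. by move=> fg; rewrite /avg (eq_bigr g). Qed.

Lemma avg_const (R : realFieldType) (T : finType) (a : R) :
  avg (fun _ : {set T} => a) = a.
Proof. by rewrite /avg sum_const_sets mulfK// lt0r_neq0// card_sets_gt0. Qed.

Lemma avgZ (R : realFieldType) (T : finType) (a : R) (f : {set T} -> R) :
  avg (fun x => a * f x) = a * avg f.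
Proof. by rewrite /avg -mulr_sumr mulrA. Qed.

Lemma avg_le (R : realFieldType) (T : finType) (f : {set T} -> R) (c : R) :
  (forall x, f x <= c) -> avg f <= c.
Proof.
move=> fc; rewrite ler_pdivrMr ?card_sets_gt0//.
by apply: le_trans (ler_sum _ (fun x _ => fc x)) _; rewrite sum_const_sets.
Qed.

Lemma avg_prod3_le (R : realFieldType) (T : finType) (c : R)
    (f g h : {set T} -> R) :
  (forall x y z, f x * g y * h z <= c) -> avg f * avg g * avg h <= c.
Proof.
move=> fgh_c; rewrite -avgZ; apply: avg_le => z /=.
rewrite mulrAC [_ * h z]mulrC -avgZ; apply: avg_le => y /=.
rewrite mulrC mulrA -avgZ; apply: avg_le => x /=.
by have := fgh_c x y z; congr (_ <= c); ring.
Qed.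

Definition Pr (R : realFieldType) (T : finType) (A : {set {set T}}) : R :=
  avg (fun x => (x \in A)%:R).

(** * Tensorization *)

Definition resample (T : finType) (B x z : {set T}) : {set T} :=
  (x :\: B) :|: (z :&: B).

Lemma resampleK (T : finType) (B x z : {set T}) :
  resample B (resample B x z) (resample B z x) = x.
Proof. by apply/setP=> e; rewrite !inE; case: (e \in B); rewrite ?andbF ?andbT ?orbF. Qed.

Lemma resampleI (T : finType) (B x z : {set T}) :
  resample B x z :&: B = z :&: B.
Proof. by apply/setP=> e; rewrite !inE; case: (e \in B); rewrite ?andbF ?andbT. Qed.

Lemma resampleI_disjoint (T : finType) (B C x z : {set T}) :
  [disjoint B & C] -> resample B x z :&: C = x :&: C.
Proof.
move=> BC; apply/setP=> e; rewrite !inE.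
have [eC|] := boolP (e \in C); last by rewrite !andbF.
by rewrite (disjointFl BC eC) !andbT andbF orbF.
Qed.

(** Exchanging the B-parts of x and z is an involution of the set of pairs
    (x, z), so the resampled set is again uniform. *)
Lemma avg_resample (R : realFieldType) (T : finType) (B : {set T})
    (f : {set T} -> R) :
  avg (fun x => avg (fun z => f (resample B x z))) = avg f.
Proof.
have N0 := lt0r_neq0 (card_sets_gt0 R T).
rewrite {1}/avg -mulr_suml; congr (_ / _); apply: (mulIf N0).
rewrite divfK// (pair_big xpredT xpredT) /=.
pose sw (p : {set T} * {set T}) := (resample B p.1 p.2, resample B p.2 p.1).
have swK : involutive sw by case=> x z; rewrite /sw /= !resampleK.
rewrite (reindex_inj (inv_inj swK)) /= (eq_bigr (fun p => f p.1)); last first.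
  by move=> p _; rewrite resampleK.
rewrite -(pair_big xpredT xpredT (fun x _ => f x)) /= mulr_suml.
by apply: eq_bigr => x _; rewrite sum_const_sets.
Qed.

(** The bounding constant c is what remains of the other blocks when these are
    fixed, and it is arbitrary so that the inequality can be iterated. *)
Definition block_ineq (R : realFieldType) (T : finType)
    (K : {set T} -> {set T} -> {set T} -> R) (B : {set T}) (C : R) : Prop :=
  forall (u v w : {set T} -> R) (c : R), 0 <= c ->
    (forall x, 0 <= u x) -> (forall x, 0 <= v x) -> (forall x, 0 <= w x) ->
    (forall x, u (x :&: B) = u x) -> (forall x, v (x :&: B) = v x) ->
    (forall x, w (x :&: B) = w x) ->
    (forall x y z, u x * v y * w z <= c * K (x :&: B) (y :&: B) (z :&: B)) ->
  avg u * avg v * avg w <= c * C.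

Lemma resample_trace (T : finType) (B x z : {set T}) :
  resample B x (z :&: B) = resample B x z.
Proof. by rewrite /resample -setIA setIid. Qed.

(** Averaging f, g and h over one block at a time preserves their averages. By the
    inequality for that block it also preserves the pointwise bound, with the
    kernel of the block replaced by the constant C. Once all the blocks are
    exhausted, the bound no longer depends on the arguments. *)
Lemma avg_tensor (R : realFieldType) (T : finType) (I : eqType)
    (K : {set T} -> {set T} -> {set T} -> R) (B : I -> {set T}) (C : R)
    (s : seq I) (f g h : {set T} -> R) :
  0 <= C -> (forall x y z, 0 <= K x y z) ->
  (forall i j, i != j -> [disjoint B i & B j]) ->
  (forall i, block_ineq K (B i) C) ->
  uniq s -> (forall x, 0 <= f x) -> (forall x, 0 <= g x) ->
  (forall x, 0 <= h x) ->
  (forall x y z, f x * g y * h z <=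
     \prod_(i <- s) K (x :&: B i) (y :&: B i) (z :&: B i)) ->
  avg f * avg g * avg h <= C ^+ size s.
Proof.
move=> C0 K0 dB locB us f0 g0 h0.
(* The factor c collects the constants of the blocks already averaged out. *)
suff scaled c : 0 <= c ->
    (forall x y z, f x * g y * h z <=
       c * \prod_(i <- s) K (x :&: B i) (y :&: B i) (z :&: B i)) ->
    avg f * avg g * avg h <= c * C ^+ size s.
  by move=> fgh; rewrite -[C ^+ _]mul1r; apply: scaled => // x y z; rewrite mul1r.
elim: s us f g h f0 g0 h0 c => [|i s IHs] /=.
  move=> _ f g h f0 g0 h0 c c0 fgh; rewrite expr0 mulr1.
  by apply: avg_prod3_le => x y z; have := fgh x y z; rewrite big_nil mulr1.
move=> /andP[iNs us] f g h f0 g0 h0 c c0 fgh.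
rewrite -(avg_resample (B i) f) -(avg_resample (B i) g) -(avg_resample (B i) h).
pose av (k : {set T} -> R) x := avg (fun z => k (resample (B i) x z)).
rewrite exprS [c * _]mulrA; apply: (IHs us (av f) (av g) (av h)) => //.
- by move=> x; apply: avg_ge0.
- by move=> x; apply: avg_ge0.
- by move=> x; apply: avg_ge0.
- exact: mulr_ge0.
move=> x y z; rewrite [c * C * _]mulrAC; apply: (locB i (fun a => f (resample (B i) x a))
  (fun a => g (resample (B i) y a)) (fun a => h (resample (B i) z a))) => //.
- by rewrite mulr_ge0// prodr_ge0.
- by move=> a; rewrite resample_trace.
- by move=> a; rewrite resample_trace.
- by move=> a; rewrite resample_trace.
move=> a b d; apply: le_trans (fgh _ _ _) _; rewrite big_cons !resampleI.
rewrite [X in c * X]mulrC mulrA ler_wpM2r// ler_wpM2l//.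
rewrite !big_seq; apply: ler_prod => j js; rewrite K0 /=.
have ij : i != j by apply: contraNneq iNs => ->.
by rewrite !resampleI_disjoint ?dB.
Qed.

(** * Sets at a large Hamming distance *)

(** Under the constraint a * b <= c^2 the sum is largest when the two numbers are
    as unequal as allowed, a = c (1 + 2 eps) and b = c / (1 + 2 eps). The excess
    over 2c is then of second order in eps. *)
Lemma sum_le_of_prod_le (R : realFieldType) (a b c eps : R) :
  0 <= eps -> 0 <= c -> 0 <= a -> 0 <= b ->
  a <= c * (1 + 2 * eps) -> b <= c * (1 + 2 * eps) -> a * b <= c * c ->
  a + b <= 2 * (c * (1 + 2 * eps ^+ 2)).
Proof.
move=> e0 c0; wlog ba : a b / b <= a.
  move=> W a0 b0 a1 b1 ab; have [ba|/ltW ab'] := leP b a; first exact: W.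
  by rewrite addrC; apply: W => //; rewrite mulrC.
move=> a0 b0 a1 _ ab; have ce : 0 <= c * eps ^+ 2 by rewrite mulr_ge0 ?sqr_ge0.
have [ac|ca] := leP a c; first lra.
have a_gt0 : 0 < a by apply: le_lt_trans ca.
have sq : (a - c) ^+ 2 <= 4 * (c * eps ^+ 2) * c.
  have -> : 4 * (c * eps ^+ 2) * c = (2 * (c * eps)) ^+ 2 by ring.
  by rewrite ler_sqr ?nnegrE ?subr_ge0 ?(ltW ca) ?mulr_ge0//; lra.
have sq' : 4 * (c * eps ^+ 2) * c <= 4 * (c * eps ^+ 2) * a.
  by rewrite ler_wpM2l ?(ltW ca)// mulr_ge0.
rewrite -(ler_pM2r a_gt0).
have -> : 2 * (c * (1 + 2 * eps ^+ 2)) * a = 2 * c * a + 4 * (c * eps ^+ 2) * a.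
  by ring.
have -> : (a + b) * a = a * a + a * b by ring.
have := le_trans sq sq'; set k := 4 * _ * a.
have -> : (a - c) ^+ 2 = a * a + c * c - 2 * c * a by ring.
lra.
Qed.

(** The first-order error 2 eps off the diagonal turns into a second-order one:
    the terms u x * v y and u y * v x cannot both be large, because their product
    u x * v x * (u y * v y) is controlled by the diagonal. *)
Lemma off_diagonal_avg (R : realFieldType) (T : finType) (eps c : R)
    (u v w : {set T} -> R) :
  0 <= eps -> 0 <= c ->
  (forall x, 0 <= u x) -> (forall x, 0 <= v x) -> (forall x, 0 <= w x) ->
  (forall x z, u x * v x * w z <= c) ->
  (forall x y z, u x * v y * w z <= c * (1 + 2 * eps)) ->
  avg u * avg v * avg w <= c * (1 + 2 * eps ^+ 2).
Proof.
move=> e0 c0 u0 v0 w0 diag all.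
rewrite -avgZ; apply: avg_le => z /=.
have pairle x y : u x * v y * w z + u y * v x * w z <= 2 * (c * (1 + 2 * eps ^+ 2)).
  set a := u x * v y * w z; set b := u y * v x * w z.
  have a1 : a <= c * (1 + 2 * eps) by apply: all.
  have b1 : b <= c * (1 + 2 * eps) by apply: all.
  have a0 : 0 <= a by rewrite !mulr_ge0.
  have b0 : 0 <= b by rewrite !mulr_ge0.
  have ab : a * b <= c * c.
    have -> : a * b = (u x * v x * w z) * (u y * v y * w z) by rewrite /a/b; ring.
    by rewrite ler_pM// ?mulr_ge0.
  exact: sum_le_of_prod_le.
have N0 := card_sets_gt0 R T.
have -> : avg u * avg v * w z =
    (\sum_x u x) * (\sum_x v x) * w z / (#|{set T}|%:R * #|{set T}|%:R).
  rewrite /avg; move: (\sum_x u x) (\sum_x v x) (#|_|%:R) N0 => a b N N0.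
  by field; rewrite lt0r_neq0.
rewrite ler_pdivrMr ?mulr_gt0//.
rewrite -(@ler_pM2l _ 2)//.
have -> : 2 * ((\sum_x u x) * (\sum_x v x) * w z) =
  \sum_x \sum_y (u x * v y * w z + u y * v x * w z).
  rewrite [RHS](eq_bigr (fun x => \sum_y u x * v y * w z + \sum_y u y * v x * w z)); last first.
    by move=> x _; rewrite big_split.
  rewrite big_split /= [X in _ = _ + X]exchange_big /= mulr2n mulrDl mul1r.
  rewrite big_distrlr /= mulr_suml.
  by congr (_ + _); apply: eq_bigr => x _; rewrite mulr_suml.
apply: le_trans (ler_sum _ (fun x _ => ler_sum _ (fun y _ => pairle x y))) _.
rewrite !sum_const_sets; move: (#|_|%:R) => N.
by rewrite [leRHS](_ : _ = 2 * (c * (1 + 2 * eps ^+ 2)) * N * N)//; ring.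
Qed.

Lemma hamming_ineq (R : realFieldType) (T : finType) (eps : R) (B : {set T}) :
  0 <= eps ->
  block_ineq (fun x y _ => if x == y then 1 else 1 + 2 * eps) B
    (1 + 2 * eps ^+ 2).
Proof.
move=> e0 u v w c c0 u0 v0 w0 uB vB wB uvw; apply: off_diagonal_avg => //.
  by move=> x z; have := uvw x x z; rewrite eqxx mulr1.
move=> x y z; apply: le_trans (uvw x y z) _; rewrite ler_wpM2l//.
by case: ifP => // _; lra.
Qed.

Lemma expR_le_linear (R : realType) (eps : R) :
  0 <= eps -> eps <= 2^-1 -> expR eps <= 1 + 2 * eps.
Proof.
move=> e0 e1; have := expR_ge1Dx (- eps); rewrite expRN => H.
have e2 : 0 < 1 - eps by lra.
have := expR_gt0 eps; move: H; set E := expR eps => H E0.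
have {}H : (1 - eps) * E <= 1 by rewrite -ler_pdivlMr// mul1r.
rewrite -(ler_pM2l e2); apply: le_trans H _; nra.
Qed.

(** Tensorize with kernel 1 where x and y agree and 1 + 2 eps >= e^eps where they
    differ. The indicators of A1 and A2 meet the resulting bound even after
    multiplication by e^(eps tau). *)
Lemma separated_blocks_Pr (R : realType) (T : finType) (n : nat)
    (B : 'I_n -> {set T}) (A1 A2 : {set {set T}}) (eps tau : R) :
  (forall i j, i != j -> [disjoint B i & B j]) ->
  0 <= eps -> eps <= 2^-1 ->
  (forall x y, x \in A1 -> y \in A2 ->
     tau <= #|[set i | x :&: B i != y :&: B i]|%:R) ->
  Pr R A1 * Pr R A2 <= expR (2 * n%:R * eps ^+ 2 - eps * tau).
Proof.
move=> dB e0 e1 sep; have th0 : 0 <= 1 + 2 * eps by lra.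
pose K (x y _ : {set T}) := if x == y then 1 else 1 + 2 * eps.
have C0 : 0 <= 1 + 2 * eps ^+ 2 by rewrite addr_ge0 ?mulr_ge0 ?sqr_ge0.
have := @avg_tensor R T _ K B _ (enum 'I_n) (fun x => (x \in A1)%:R)
  (fun y => (y \in A2)%:R) (fun=> expR (eps * tau)) C0.
rewrite size_enum_ord avg_const => /(_ _ dB) main.
rewrite expRD expRN -ler_pdivrMr ?invr_gt0 ?expR_gt0// invrK.
apply: le_trans (main _ _ _ _ _ _ _) _ => //.
- by move=> x y z; rewrite /K; case: ifP.
- by move=> i; apply: hamming_ineq.
- exact: enum_uniq.
- by move=> _; rewrite expR_ge0.
- move=> x y z.
  have prodE : \prod_(i <- enum 'I_n) K (x :&: B i) (y :&: B i) (z :&: B i) =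
      (1 + 2 * eps) ^+ #|[set i | x :&: B i != y :&: B i]|.
    rewrite big_enum /= -prodr_const big_mkcond [RHS]big_mkcond /=.
    by apply: eq_bigr => i _; rewrite inE /K; case: eqP.
  rewrite prodE; have [xA|] := boolP (x \in A1); last first.
    by rewrite !mul0r exprn_ge0.
  have [yA|] := boolP (y \in A2); last by rewrite mulr0 mul0r exprn_ge0.
  rewrite !mul1r; set m := #|_|.
  apply: (@le_trans _ _ (expR eps ^+ m)).
    by rewrite -expRM_natr ler_expR ler_wpM2l// sep.
  by rewrite lerXn2r ?nnegrE ?expR_ge0 ?expR_le_linear.
rewrite [_ * _ * eps ^+ 2]mulrAC expRM_natr lerXn2r ?nnegrE ?expR_ge0//.
exact: expR_ge1Dx.
Qed.

(** * Families any three members of which miss many points *)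

(** With P = a1 a2 a3, multiplying the left-hand side by P^2 turns it into
    (P + b1 a2 a3) (P + a1 b2 a3) (P + a1 a2 b3) <= (P + c)^3, and
    (P + c)^3 <= 8 P^2 c for c <= P <= 2c. *)
Lemma prod_of_sums_le (R : realFieldType) (a1 b1 a2 b2 a3 b3 c : R) :
  0 <= a1 -> 0 <= a2 -> 0 <= a3 -> 0 <= b1 -> 0 <= b2 -> 0 <= b3 -> 0 <= c ->
  a1 * a2 * a3 <= 2 * c -> b1 * a2 * a3 <= c -> a1 * b2 * a3 <= c ->
  a1 * a2 * b3 <= c -> b1 * b2 * a3 <= c -> b1 * a2 * b3 <= c ->
  a1 * b2 * b3 <= c -> b1 * b2 * b3 <= c ->
  (a1 + b1) * (a2 + b2) * (a3 + b3) <= 8 * c.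
Proof.
move=> a10 a20 a30 b10 b20 b30 c0 H H1 H2 H3 H12 H13 H23 H123.
set P := a1 * a2 * a3 in H *.
have [Pc|cP] := leP P c.
  have -> : (a1 + b1) * (a2 + b2) * (a3 + b3) = P + b1 * a2 * a3 + a1 * b2 * a3
    + a1 * a2 * b3 + b1 * b2 * a3 + b1 * a2 * b3 + a1 * b2 * b3 + b1 * b2 * b3.
    by rewrite /P; ring.
  lra.
have P0 : 0 < P by apply: le_lt_trans cP.
have P20 : 0 < P ^+ 2 by rewrite exprn_gt0.
rewrite -(@ler_pM2l _ (P ^+ 2))//.
have -> : P ^+ 2 * ((a1 + b1) * (a2 + b2) * (a3 + b3)) =
   (P + b1 * a2 * a3) * (P + a1 * b2 * a3) * (P + a1 * a2 * b3) by rewrite /P; ring.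
apply: (@le_trans _ _ ((P + c) ^+ 3)).
  rewrite !exprS expr0 mulr1 mulrA.
  have P0' := ltW P0.
  by rewrite !ler_pM ?lerD2l// ?mulr_ge0// ?addr_ge0// ?mulr_ge0.
have -> : P ^+ 2 * (8 * c) = (P + c) ^+ 3 + (P - c) * ((2 * c - P) * P + c * (2 * P + c)) by ring.
rewrite lerDl; apply: mulr_ge0; first by rewrite subr_ge0 ltW.
by rewrite addr_ge0// mulr_ge0 ?subr_ge0 ?(ltW P0)//; nra.
Qed.

Lemma avg_singleton (R : realFieldType) (T : finType) (e : T) (u : {set T} -> R) :
  (forall x, u (x :&: [set e]) = u x) -> avg u = (u set0 + u [set e]) / 2.
Proof.
move=> ue; have N0 := lt0r_neq0 (card_sets_gt0 R T).
have uE x : u x + u (~: x) = u set0 + u [set e].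
  wlog ex : x / e \in x.
    move=> W; have [/W//|exN] := boolP (e \in x).
    by rewrite addrC -[in X in _ + X](setCK x) W// inE.
  have -> : u x = u [set e] by rewrite -ue (setIidPr _) ?sub1set.
  have -> : u (~: x) = u set0; last exact: addrC.
  rewrite -ue; congr u; apply/setP=> d; rewrite !inE.
  by case: eqP => [->|]; rewrite ?ex ?andbF.
have two0 : 2 != 0 :> R by rewrite pnatr_eq0.
apply: (mulIf N0); rewrite /avg divfK//; apply: (mulIf two0).
rewrite [RHS]mulrAC divfK// mulr_natr mulr2n.
rewrite [X in _ + X](reindex_inj (inv_inj (@setCK T))) /= -big_split /=.
by rewrite (eq_bigr _ (fun x _ => uE x)) sum_const_sets.
Qed.

Lemma triple_ineq (R : realFieldType) (T : finType) (theta : R) (e : T) :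
  theta <= 2 ->
  block_ineq (fun x y z => if [&& x == set0, y == set0 & z == set0]
                           then theta else 1) [set e] 1.
Proof.
move=> th2 u v w c c0 u0 v0 w0 uB vB wB uvw; rewrite mulr1 !(avg_singleton (e := e))//.
have en0 : ([set e] == set0) = false by apply/negP=> /eqP/setP/(_ e); rewrite !inE eqxx.
have uvw' (x y z : {set T}) : x \in [:: set0; [set e]] -> y \in [:: set0; [set e]] ->
   z \in [:: set0; [set e]] -> u x * v y * w z <=
   c * (if [&& x == set0, y == set0 & z == set0] then theta else 1).
  have tr (a : {set T}) : a \in [:: set0; [set e]] -> a :&: [set e] = a.
    by rewrite !inE => /orP[] /eqP ->; rewrite ?set0I ?setIid.
  by move=> xe ye ze; have := uvw x y z; rewrite !tr.
have := @prod_of_sums_le R (u set0) (u [set e]) (v set0) (v [set e]) (w set0) (w [set e]) c.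
have -> : (u set0 + u [set e]) / 2 * ((v set0 + v [set e]) / 2) *
   ((w set0 + w [set e]) / 2) = (u set0 + u [set e]) * (v set0 + v [set e]) *
   (w set0 + w [set e]) / 8 by field.
rewrite ler_pdivrMr// [c * 8]mulrC; apply => //.
  apply: le_trans (uvw' _ _ _ _ _ _) _; rewrite ?inE ?eqxx ?orbT//= mulrC.
  by rewrite ler_wpM2r.
all: by apply: le_trans (uvw' _ _ _ _ _ _) _;
  rewrite ?inE ?eqxx ?orbT//= ?en0 ?andbF ?mulr1.
Qed.

(** Each point missed by all three sets gains a factor e^(1/2) <= 2, and 2 is the
    gain on a single coordinate that the inequality on products of sums of two
    terms can absorb. *)
Lemma three_wise_Pr (R : realType) (T : finType) (A : {set {set T}}) (tau : R) :
  (forall x y z, x \in A -> y \in A -> z \in A ->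
     tau <= #|~: (x :|: y :|: z)|%:R) ->
  Pr R A ^+ 3 <= expR (- (tau / 2)).
Proof.
move=> sep; set th := expR (2^-1 : R).
have th2 : th <= 2 by apply: le_trans (expR_le_linear _ _) _ => //; lra.
have th0 : 0 <= th by apply: expR_ge0.
pose K (x y z : {set T}) := if [&& x == set0, y == set0 & z == set0] then th else 1.
have := @avg_tensor R T _ K (fun e => [set e]) 1 (enum T) (fun x => (x \in A)%:R)
  (fun y => (y \in A)%:R) (fun z => expR (tau / 2) * (z \in A)%:R) ler01.
rewrite expr1n avgZ -/(Pr R A) => main.
suff : Pr R A * Pr R A * (expR (tau / 2) * Pr R A) <= 1.
  move=> le1; rewrite expRN -[leRHS]mul1r ler_pdivlMr ?expR_gt0//; move: le1.
  by move: (Pr R A) (expR _) => p E; congr (_ <= 1); ring.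
apply: main => //.
- by move=> x y z; rewrite /K; case: ifP.
- by move=> i j ij; rewrite disjoints1 inE.
- by move=> i; apply: triple_ineq.
- exact: enum_uniq.
- by move=> z; rewrite mulr_ge0 ?expR_ge0.
move=> x y z.
have prodE : \prod_(e <- enum T) K (x :&: [set e]) (y :&: [set e]) (z :&: [set e]) =
    th ^+ #|~: (x :|: y :|: z)|.
  rewrite big_enum /= -prodr_const big_mkcond [RHS]big_mkcond /=.
  apply: eq_bigr => e _; rewrite !inE /K.
  have tr (a : {set T}) : (a :&: [set e] == set0) = (e \notin a).
    by rewrite setI_eq0 disjoint_sym disjoints1.
  by rewrite !tr !negb_or -andbA.
rewrite prodE; have [xA|] := boolP (x \in A); last by rewrite !mul0r exprn_ge0.
have [yA|] := boolP (y \in A); last by rewrite mulr0 mul0r exprn_ge0.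
have [zA|] := boolP (z \in A); last by rewrite !mulr0 exprn_ge0.
by rewrite !mul1r mulr1 -expRM_natr ler_expR mulrC ler_pM2l ?invr_gt0// sep.
Qed.

(** * Colourings and random subgraphs *)

Lemma chi_le_card (G : sgraph) (C : finType) (D : {set C}) (f : G -> C) :
  (forall v, f v \in D) -> (forall u v, adj u v -> f u != f v) ->
  (chi G <= #|D|)%N.
Proof.
move=> fD fP; rewrite /chi; case: ex_minnP => m _; apply.
apply/existsP; exists [ffun v => enum_rank_in (fD v) (f v)].
apply/forallP=> u; apply/forallP=> v; apply/implyP=> /fP.
by rewrite !ffunE; apply: contraNneq => /enum_rank_in_inj ->.
Qed.

Lemma chi_coloring (G : sgraph) :
  exists f : G -> 'I_(chi G), forall u v, adj u v -> f u != f v.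
Proof.
rewrite /chi; case: ex_minnP => m /existsP[f /forallP fP] _.
by exists f => u v uv; have /forallP/(_ v)/implyP := fP u; apply.
Qed.

(** Edges as a type of their own, so that the random subgraph is a uniformly
    distributed set. *)
Definition edge_type (G : sgraph) := {e : {set G} | e \in edges G}.

Definition subgraph_of (G : sgraph) (x : {set edge_type G}) : sgraph :=
  spanning_subgraph [set val e | e in x].

Lemma edge_in (G : sgraph) (u v : G) : adj u v -> [set u; v] \in edges G.
Proof. by move=> uv; apply/imsetP; exists (u, v); rewrite // inE. Qed.

Definition edge_of (G : sgraph) (u v : G) (uv : adj u v) : edge_type G :=
  exist _ [set u; v] (edge_in uv).

Lemma adj_subgraph_of (G : sgraph) (x : {set edge_type G}) (u v : G)
    (uv : adj u v) :
  edge_of uv \in x -> @adj (subgraph_of x) u v.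
Proof.
by move=> ex; rewrite /= /sub_adj uv /=; apply/imsetP; exists (edge_of uv).
Qed.

Lemma Gp_prob_half (R : realFieldType) (G : sgraph) (A : pred sgraph) :
  Gp_prob (2^-1 : R) G A =
  (\sum_(x : {set edge_type G}) (A (subgraph_of x))%:R) / #|{set edge_type G}|%:R.
Proof.
rewrite /Gp_prob (eq_bigr (fun=> 2^-1 ^+ #|edges G|)); last first.
  move=> F _; rewrite /Gp_weight -prodr_const; apply: eq_bigr => e _.
  by case: ifP => // _; field.
have cardS : #|{set edge_type G}| = (2 ^ #|edges G|)%N.
  by rewrite -cardsT -powersetT card_powerset cardsT card_sig.
rewrite cardS natrX -exprVn mulr_suml.
rewrite (reindex_onto (fun x : {set edge_type G} => [set val e | e in x])
  (fun F : {set {set G}} => [set e | val e \in F])) /=; last first.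
  move=> F /andP[+ _]; rewrite powersetE => /subsetP FE; apply/setP=> e.
  apply/imsetP/idP => [[d]|eF]; first by rewrite inE => ? ->.
  by exists (exist _ e (FE e eF)); rewrite ?inE.
rewrite big_mkcond /=; apply: eq_bigr => x _.
have -> : [set e | val e \in [set val e0 | e0 in x]] == x.
  by apply/eqP/setP=> e; rewrite inE mem_imset //; apply: val_inj.
rewrite powersetE andbT (_ : _ \subset _) /=; last first.
  by apply/subsetP=> _ /imsetP[e _ ->]; apply: (valP e).
by rewrite /subgraph_of; case: (A _); rewrite ?mul1r ?mul0r.
Qed.

(** * Two colourable subgraphs and the blocks of a colouring *)

(** This exposes the classes of the colouring f in order, block i holding the
    edges from class i to the earlier classes. *)
Definition block (G : sgraph) (k : nat) (f : G -> 'I_k) (i : 'I_k) :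
    {set edge_type G} :=
  [set e : edge_type G | \max_(v in val e) (f v : nat) == i].

Lemma block_disjoint (G : sgraph) (k : nat) (f : G -> 'I_k) (i j : 'I_k) :
  i != j -> [disjoint block f i & block f j].
Proof.
move=> ij; rewrite -setI_eq0; apply/eqP/setP=> e; rewrite !inE.
apply/negP=> /andP[/eqP ei /eqP ej]; case/negP: ij; apply/eqP/val_inj.
by rewrite /= -ei.
Qed.

(** What matters is only that an edge whose ends both have their colour outside
    a set J of blocks is itself in a block outside J. *)
Lemma edge_of_block (G : sgraph) (k : nat) (f : G -> 'I_k) (u v : G)
    (uv : adj u v) :
  edge_of uv \in block f (f u) \/ edge_of uv \in block f (f v).
Proof.
have uNv : u \notin [set v].
  by rewrite inE; apply: contraTneq uv => ->; rewrite adj_irr.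
rewrite !inE /= big_setU1//= big_set1; case: (leqP (f u) (f v)) => [uv'|vu].
  by right; apply/eqP; lia.
by left; apply/eqP; lia.
Qed.

(** Blocks where x and y differ cost one colour each, and elsewhere G is the union
    of x and the complement of y. *)
Lemma separated_blocks (G : sgraph) (f : G -> 'I_(chi G))
    (x y : {set edge_type G}) :
  (forall u v, adj u v -> f u != f v) ->
  (chi G <= chi (subgraph_of x) * chi (subgraph_of (~: y)) +
    #|[set i | x :&: block f i != y :&: block f i]|)%N.
Proof.
move=> fP; set J := [set i | _].
have [a aP] := chi_coloring (subgraph_of x).
have [b bP] := chi_coloring (subgraph_of (~: y)).
pose c (v : G) : 'I_(chi (subgraph_of x)) * 'I_(chi (subgraph_of (~: y))) + 'I_(chi G)
  := if f v \in J then inr (f v) else inl (a v, b v).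
pose D := [set inl p | p in setT] :|: [set inr i | i in J] :
  {set 'I_(chi (subgraph_of x)) * 'I_(chi (subgraph_of (~: y))) + 'I_(chi G)}.
apply: (@leq_trans #|D|).
  apply: (chi_le_card (f := c)) => [v|u v uv].
    rewrite /D inE /c; case: ifP => vJ; apply/orP; [right|left].
      by apply/imsetP; exists (f v).
    by apply/imsetP; exists (a v, b v).
  rewrite /c; case: ifPn => uJ; case: ifPn => vJ //.
    by apply: contra (fP _ _ uv) => /eqP[->].
  suff : (a u != a v) || (b u != b v).
    by apply: contraTneq => -[-> ->]; rewrite !eqxx.
  have [ex|exN] := boolP (edge_of uv \in x); first by rewrite aP// adj_subgraph_of.
  rewrite [b u != _]bP ?orbT//; apply: (adj_subgraph_of (uv := uv)); rewrite inE.
  apply: contra exN => ey.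
  have agree i : i \notin J -> edge_of uv \in block f i -> edge_of uv \in x.
    rewrite inE negbK => /eqP/setP/(_ (edge_of uv)); rewrite !in_setI ey.
    by move=> + ei; rewrite ei !andbT => ->.
  by case: (edge_of_block f uv); apply: agree.
apply: leq_trans (leq_card_setU _ _) _; rewrite !card_imset; last first.
- by move=> ? ? [].
- by move=> ? ? [].
by rewrite cardsT card_prod !card_ord.
Qed.

(** * Monochromatic edges *)

Lemma sqr_sum_le (I : finType) (F : I -> nat) :
  ((\sum_i F i) ^ 2 <= #|I| * \sum_i F i ^ 2)%N.
Proof.
rewrite -(leq_pmul2l (isT : 0 < 2)%N).
rewrite -mulnn big_distrlr /=.
apply: (@leq_trans (\sum_i \sum_j (F i ^ 2 + F j ^ 2))); last first.
  rewrite (eq_bigr (fun i => #|I| * F i ^ 2 + \sum_j F j ^ 2))%N; last first.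
    by move=> i _; rewrite big_split /= sum_nat_const.
  by rewrite big_split /= sum_nat_const -big_distrr /= mul2n addnn.
rewrite big_distrr /= leq_sum// => i _; rewrite big_distrr /= leq_sum// => j _.
exact: nat_Cauchy.
Qed.

Lemma sum_card_fiber (Q C : finType) (P : {set Q}) (l : Q -> C) :
  (\sum_a #|[set q in P | l q == a]| = #|P|)%N.
Proof.
rewrite -sum1_card (partition_big l predT)//=; apply: eq_bigr => a _.
by rewrite -sum1_card; apply: eq_bigl => q; rewrite inE.
Qed.

Lemma sum_card_fiber_sqr (Q C : finType) (P : {set Q}) (l : Q -> C) :
  (\sum_a #|[set q in P | l q == a]| ^ 2 = #|P| +
   #|[set p : Q * Q | [&& p.1 \in P, p.2 \in P, l p.1 == l p.2 & p.1 != p.2]]|)%N.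
Proof.
set S := [set p | _].
pose E := [set p : Q * Q | [&& p.1 \in P, p.2 \in P & l p.1 == l p.2]].
transitivity #|E|.
  rewrite -[RHS]sum1_card (partition_big (fun p : Q * Q => l p.1) predT)//=.
  apply: eq_bigr => a _; rewrite -mulnn -cardsX -sum1_card.
  apply: eq_bigl => -[p q]; rewrite !inE /=.
  case: (p \in P) => //=; case: (q \in P); rewrite ?andbF //=.
  by have [<-|] := eqVneq (l p) a; rewrite ?andbT ?andbF// eq_sym.
rewrite -(cardsID [set (q, q) | q in P] E); congr (_ + _)%N.
  rewrite -(card_imset P (f := fun q => (q, q))); last by move=> ? ? [].
  apply: eq_card => p; rewrite inE andbC; case: imsetP => // -[q qP ->].
  by rewrite inE /= qP eqxx.
apply: eq_card => -[p q]; rewrite !inE /=.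
have -> : ((p, q) \in [set (r, r) | r in P]) = (p \in P) && (p == q).
  apply/imsetP/andP => [[r rP [-> ->]]|[pP /eqP <-]]; first by rewrite rP eqxx.
  by exists p.
by case: (p \in P); case: (q \in P); case: (l p == l q); case: (p == q).
Qed.

Definition mono_edges (G : sgraph) (C : finType) (c : G -> C) :
    {set edge_type G} :=
  [set e : edge_type G | [exists u, [exists v, [&& adj u v, c u == c v & val e == [set u; v]]]]].

(** Remembering the order of the two ends makes an edge determine the couple. *)
Lemma mono_pairs_le (G : sgraph) (C : finType) (c : G -> C) :
  (#|[set p : G * G | adj p.1 p.2 && (c p.1 == c p.2)]| <= 2 * #|mono_edges c|)%N.
Proof.
set M := [set p | _].
pose h (p : G * G) := ([set p.1; p.2], (enum_rank p.1 < enum_rank p.2)%N).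
have hinj : {in M &, injective h}.
  move=> [u v] [u' v'] _ _ [/= E R].
  have : u \in [set u'; v'] by rewrite -E set21.
  have : v \in [set u'; v'] by rewrite -E set22.
  have : u' \in [set u; v] by rewrite E set21.
  have : v' \in [set u; v] by rewrite E set22.
  rewrite !inE => /orP[]/eqP ? /orP[]/eqP ? /orP[]/eqP ? /orP[]/eqP ?; subst => //.
  by move: R; case: ltngtP => // /val_inj/enum_rank_inj ->.
rewrite -(card_in_imset hinj) mulnC -(card_imset _ val_inj) -card_bool -cardsT -cardsX.
apply/subset_leq_card/subsetP=> _ /imsetP[[u v] + ->]; rewrite !inE /= andbT.
move=> /andP[uv cuv]; apply/imsetP; exists (edge_of uv) => //.
by rewrite inE; apply/existsP; exists u; apply/existsP; exists v; rewrite uv cuv /=.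
Qed.

(** Among the maps g such that (c, g) is a proper colouring, take one using the
    fewest colour pairs. Two pairs (a, i) and (a, j) with the same first component
    must be joined by an edge, else they could be merged, and this edge is
    monochromatic for c. There are at least chi G pairs in all, and the
    Cauchy-Schwarz inequality bounds below the number of couples of pairs with
    equal first component. *)
Lemma mono_edges_lb (G : sgraph) (C : finType) (c : G -> C) :
  (chi G ^ 2 <= #|C| * (chi G + 2 * #|mono_edges c|))%N.
Proof.
pose proper (g : {ffun G -> 'I_#|G|}) :=
  [forall u, forall v, adj u v ==> ((c u, g u) != (c v, g v))].
pose img (g : {ffun G -> 'I_#|G|}) := [set (c v, g v) | v in G].
have g0P : proper [ffun v => enum_rank v].
  apply/forallP=> u; apply/forallP=> v; apply/implyP; apply: contraTneq.
  by case=> _; rewrite !ffunE => /enum_rank_inj ->; rewrite adj_irr.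
case: (arg_minnP (fun g => #|img g|) g0P) => g /forallP gP gmin.
set P := img g in gmin.
have kP : (chi G <= #|P|)%N.
  apply: (chi_le_card (f := fun v => (c v, g v))) => [v|u v uv].
    exact: imset_f.
  by have /forallP/(_ v)/implyP := gP u; apply.
set M := [set p : G * G | adj p.1 p.2 && (c p.1 == c p.2)].
pose S := [set q : (C * 'I_#|G|) * (C * 'I_#|G|) |
  [&& q.1 \in P, q.2 \in P, q.1.1 == q.2.1 & q.1 != q.2]].
have SM : (#|S| <= #|M|)%N.
  pose h (p : G * G) := ((c p.1, g p.1), (c p.2, g p.2)).
  apply: leq_trans (leq_imset_card h _); apply/subset_leq_card/subsetP=> -[q1 q2].
  rewrite inE /= => /and4P[q1P q2P q12 q1Nq2].
  apply: contraT => noM; have noedge p : p \in M -> (q1, q2) != h p.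
    by move=> pM; apply: contraNneq noM => ->; apply: imset_f.
  (* Merge the pair q2 into q1. *)
  pose g' := [ffun v => if (c v, g v) == q2 then q1.2 else g v].
  have g'E v : (c v, g' v) = if (c v, g v) == q2 then q1 else (c v, g v).
    rewrite ffunE; case: eqP => // E; rewrite [q1]surjective_pairing.
    by rewrite (eqP q12) -E.
  have edge u v : adj u v -> (c u, g u) = q1 -> (c v, g v) = q2 -> False.
    move=> uv E1 E2; have := noedge (u, v); rewrite inE /= uv /= /h /= E1 E2 eqxx.
    move=> W; suff: false by []. apply: W.
    by move: (congr1 fst E1) (congr1 fst E2) => /= -> ->.
  have /gmin : proper g'.
    apply/forallP=> u; apply/forallP=> v; apply/implyP=> uv; rewrite !g'E.
    have guv : (c u, g u) != (c v, g v).
      by have /forallP/(_ v)/implyP := gP u; apply.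
    have [Eu|_] := eqVneq (c u, g u) q2; have [Ev|_] := eqVneq (c v, g v) q2 => //.
    - by rewrite Eu Ev eqxx in guv.
    - by apply/eqP=> Ev'; apply: (edge v u); rewrite // adj_sym.
    - by apply/eqP=> Eu'; apply: (edge u v).
  rewrite leqNgt => /negP[]; apply: proper_card; apply/properP; split.
    by apply/subsetP=> _ /imsetP[v _ ->]; rewrite g'E; case: ifP => // _; apply: imset_f.
  exists q2 => //; apply/imsetP=> -[v _]; rewrite g'E; case: ifP => [_ E|/eqP + E].
    by rewrite E eqxx in q1Nq2.
  by rewrite E.
(* If chi G <= #|C|, the claim is trivial; otherwise the lower bound for #|P| pairs
   is increasing in #|P|, so #|P| may be replaced by chi G. *)
have := sqr_sum_le (fun a => #|[set q in P | q.1 == a]|).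
rewrite sum_card_fiber (sum_card_fiber_sqr P fst) -/S => cauchy.
have := mono_pairs_le c; rewrite -/M.
by have [kC|Ck] := leqP (chi G) #|C|; nia.
Qed.
(** * Tail bounds *)

Lemma Gp_prob_Pr (R : realFieldType) (G : sgraph) (A : pred sgraph) :
  Gp_prob (2^-1 : R) G A = Pr R [set x | A (@subgraph_of G x)].
Proof. by rewrite Gp_prob_half; apply: eq_avg => x; rewrite inE. Qed.

Lemma Pr_setC (R : realFieldType) (T : finType) (A : {set {set T}}) :
  Pr R [set x | ~: x \in A] = Pr R A.
Proof.
rewrite /Pr /avg [in RHS](reindex_inj (inv_inj (@setCK T))) /=.
by congr (_ / _); apply: eq_bigr => x _; rewrite inE.
Qed.

Lemma Pr_ge0 (R : realFieldType) (T : finType) (A : {set {set T}}) : 0 <= Pr R A.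
Proof. exact: avg_ge0. Qed.

Lemma chi_half_block_tail (R : realType) (G : sgraph) (d : R) :
  (0 < chi G)%N -> 0 < d -> d ^+ 2 <= (chi G)%:R ->
  Gp_prob (2^-1 : R) G (fun H => (chi H)%:R <= d) <=
  expR (- (((chi G)%:R - d ^+ 2) ^+ 2 / (16 * (chi G)%:R))).
Proof.
move=> k0 d0 dk; rewrite Gp_prob_Pr; set A := [set x | _].
have [f fP] := chi_coloring G.
set k : R := (chi G)%:R in dk *; have {}k0 : 0 < k by rewrite ltr0n.
set tau := k - d ^+ 2; have tau0 : 0 <= tau by rewrite subr_ge0.
have tauk : tau <= k by rewrite lerBlDr lerDl sqr_ge0.
(* This minimizes the exponent 2 k eps^2 - eps tau. *)
pose eps := tau / (4 * k).
have epsk : eps * (4 * k) = tau by rewrite /eps divfK// mulf_neq0 ?lt0r_neq0.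
have e0 : 0 <= eps by rewrite divr_ge0 ?mulr_ge0 ?(ltW k0).
have e1 : eps <= 2^-1 by rewrite ler_pdivrMr ?mulr_gt0//; lra.
have := @separated_blocks_Pr R _ _ (block f) A [set x | ~: x \in A] eps tau
  (block_disjoint f) e0 e1.
rewrite Pr_setC => main.
rewrite -(ler_pXn2r (n := 2)) ?nnegrE ?Pr_ge0 ?expR_ge0//.
rewrite -expRM_natr; apply: le_trans (main _) _.
  move=> x y; rewrite !inE => xA yA; rewrite lerBlDl.
  have := separated_blocks x y fP; rewrite -(ler_nat R) natrD natrM => /le_trans.
  by apply; rewrite lerD2r expr2 ler_pM.
rewrite ler_expR -/k le_eqVlt; apply/orP; left; apply/eqP.
by rewrite /eps; field; rewrite lt0r_neq0.
Qed.

Lemma uncovered_edges (G : sgraph) (x y z : {set edge_type G}) :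
  (chi G ^ 2 <= chi (subgraph_of x) * chi (subgraph_of y) * chi (subgraph_of z) *
     (chi G + 2 * #|~: (x :|: y :|: z)|))%N.
Proof.
have [a aP] := chi_coloring (subgraph_of x).
have [b bP] := chi_coloring (subgraph_of y).
have [c cP] := chi_coloring (subgraph_of z).
have := mono_edges_lb (fun v : G => (a v, b v, c v)).
rewrite !card_prod !card_ord => /leq_trans; apply.
rewrite leq_mul2l leq_add2l leq_mul2l /=; apply/orP; right.
apply/subset_leq_card/subsetP=> e; rewrite !inE.
move=> /existsP[u /existsP[v /and3P[uv /eqP[Ea Eb Ec] /eqP Ee]]].
have -> : e = edge_of uv by apply: val_inj.
apply/negP=> /orP[/orP[]|] /adj_subgraph_of.
- by move/aP; rewrite Ea eqxx.
- by move/bP; rewrite Eb eqxx.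
- by move/cP; rewrite Ec eqxx.
Qed.

Lemma chi_half_edge_tail (R : realType) (G : sgraph) (d : R) :
  (0 < chi G)%N -> 0 < d ->
  Gp_prob (2^-1 : R) G (fun H => (chi H)%:R <= d) <=
  expR (- ((chi G)%:R * ((chi G)%:R - d ^+ 3) / (12 * d ^+ 3))).
Proof.
move=> k0 d0; rewrite Gp_prob_Pr; set A := [set x | _].
set k : R := (chi G)%:R; have d30 : 0 < d ^+ 3 by rewrite exprn_gt0.
pose tau := k * (k - d ^+ 3) / (2 * d ^+ 3).
rewrite -(ler_pXn2r (n := 3)) ?nnegrE ?Pr_ge0 ?expR_ge0//.
rewrite -expRM_natr; apply: le_trans (three_wise_Pr (tau := tau) _) _.
  move=> x y z; rewrite !inE => xA yA zA.
  have := uncovered_edges x y z; rewrite -(ler_nat R) natrX !natrM natrD natrM -/k.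
  set N := #|_|%:R => le1; have N0 : 0 <= N by apply: ler0n.
  rewrite ler_pdivrMr ?mulr_gt0//.
  have : k ^+ 2 <= d ^+ 3 * (k + 2 * N).
    apply: le_trans le1 _; apply: ler_wpM2r; first by rewrite addr_ge0 ?mulr_ge0 ?ler0n.
    by rewrite !exprS expr0 mulr1 mulrA !ler_pM ?mulr_ge0.
  move: (d ^+ 3) => D; lra.
rewrite ler_expR le_eqVlt; apply/orP; left; apply/eqP.
by rewrite /tau; field; rewrite lt0r_neq0.
Qed.

Theorem theorem1p2 (R : realType) :
  exists c : R, 0 < c /\
    forall (G : sgraph) (k : nat) (d : R), chi G = k -> 0 < d ->
      let P : R := Gp_prob 2^-1 G (fun H => (chi H)%:R <= d) in
      let sqrtk : R := Num.sqrt k%:R in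
      let cbrtk : R := k%:R `^ 3^-1 in
      [/\ sqrtk / 2 <= d <= sqrtk ->
            P <= expR (- (c * ((sqrtk - d) ^+ 2 / sqrtk))),
          cbrtk <= d <= sqrtk / 2 ->
            P <= expR (- (c * (k%:R / d))) &
          d <= cbrtk ->
            P <= expR (- (c * (k%:R * (k%:R - d ^+ 3) / d ^+ 3)))].
Proof.
exists 32^-1; split; first by rewrite invr_gt0.
move=> G k d <-{k} d0 P s q; set k : R := (chi G)%:R.
(* Without vertices, k = 0 and each hypothesis on d contradicts 0 < d. *)
have [k0|k_gt0] := posnP (chi G).
  have s0 : s = 0 by rewrite /s k0 sqrtr0.
  have q0 : q = 0 by rewrite /q k0 powR0 ?invr_eq0 ?pnatr_eq0.
  by rewrite s0 q0 mul0r; split=> [/andP[_]|/andP[_]|]; rewrite leNgt d0.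
have k1 : 1 <= k by rewrite ler1n.
have sk : s ^+ 2 = k by rewrite sqr_sqrtr ?ler0n.
have s0 : 0 <= s by apply: sqrtr_ge0.
have s1 : 1 <= s by rewrite -(sqrtr1 R) ler_wsqrtr.
have qk : q ^+ 3 = k by rewrite -powR_mulrn ?powR_ge0// -powRrM mulVf ?powRr1 ?ler0n ?pnatr_eq0.
have q1 : 1 <= q by rewrite -(ler_pXn2r (n := 3)) ?nnegrE ?powR_ge0// expr1n qk.
have s_gt0 : 0 < s by lra.
have block_tail : d <= s -> P <= expR (- ((k - d ^+ 2) ^+ 2 / (16 * k))).
  move=> ds; apply: chi_half_block_tail => //.
  by rewrite -/k -sk ler_sqr ?nnegrE ?(ltW d0).
have k_pos : 0 < 16 * k by lra.
split=> [/andP[_ ds]|/andP[qd ds]|dq].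
- apply: le_trans (block_tail ds) _; rewrite ler_expR lerN2 -sk.
  have -> : s ^+ 2 - d ^+ 2 = (s - d) * (s + d) by ring.
  have sd : s ^+ 2 <= (s + d) ^+ 2 by rewrite ler_sqr ?nnegrE; lra.
  rewrite ler_pdivlMr ?mulr_gt0 ?exprn_gt0//.
  have -> : 32^-1 * ((s - d) ^+ 2 / s) * (16 * s ^+ 2) = (s - d) ^+ 2 * (s / 2).
    by field; rewrite lt0r_neq0.
  rewrite exprMn ler_wpM2l ?sqr_ge0//; apply: le_trans sd; nra.
- have ds' : d <= s by lra.
  apply: le_trans (block_tail ds') _; rewrite ler_expR lerN2.
  have dk : d ^+ 2 <= k / 4.
    have -> : k / 4 = (s / 2) ^+ 2 by rewrite -sk; field.
    by rewrite ler_sqr ?nnegrE//; lra.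
  have kd : k / d <= k by rewrite ler_pdivrMr// ler_peMr//; lra.
  rewrite ler_pdivlMr//; move: (d ^+ 2) dk => D dk; move: (k / d) kd => K kd.
  nra.
apply: le_trans (chi_half_edge_tail k_gt0 d0) _; rewrite ler_expR lerN2 -/k.
have d3k : d ^+ 3 <= k by rewrite -qk lerXn2r ?nnegrE ?(ltW d0)//; lra.
have d3 : 0 < d ^+ 3 by rewrite exprn_gt0.
have : 0 <= k * (k - d ^+ 3) / d ^+ 3.
  by rewrite divr_ge0 ?(ltW d3)// mulr_ge0 ?subr_ge0 ?ler0n.
have -> : k * (k - d ^+ 3) / (12 * d ^+ 3) = k * (k - d ^+ 3) / d ^+ 3 / 12.
  by field; rewrite lt0r_neq0.
by move: (_ / d ^+ 3) => t t0; lra.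
Qed.
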